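(* For every integer $m\ge1$ and all $0\le k\le n$, with weights $w_j=m\lfloor j/m\rfloor$: (i) $x^{\overline{\overline n}_m}=\sum_k\mathsf c_m(n,k)\,x^k$, $\quad x^{\underline{\underline n}_m}=\sum_k(-1)^{n-k}\mathsf c_m(n,k)\,x^k$, $\quad x^n=\sum_k\mathsf S_m(n,k)\,x^{\underline{\underline k}_m}$; (ii) the lower-triangular matrices $\big((-1)^{n-k}\mathsf c_m(n,k)\big)_{n,k\ge0}$ and $\big(\mathsf S_m(n,k)\big)_{n,k\ge0}$ are inverses of each other; (iii) $\mathsf c_m(n,k)=e_{n-k}(w_0,\dots,w_{n-1})$ and $\mathsf S_m(n,k)=h_{n-k}(w_1,\dots,w_k)$, and the column generating function of the second kind is $\sum_{n\ge0}\mathsf S_m(n,k)x^n=x^k\big/\prod_{j=1}^k(1-w_jx)$; (iv) $\mathsf L_m(n,k)=\sum_j\mathsf c_m(n,j)\,\mathsf S_m(j,k)$, with recurrence $$\mathsf L_m(n+1,k)=\big(m\lfloor n/m\rfloor+m\lfloor k/m\rfloor\big)\mathsf L_m(n,k)+\mathsf L_m(n,k-1);$$ (v) the row sums of the first kind are $\sum_{k=0}^n\mathsf c_m(n,k)=\prod_{j=0}^{n-1}\big(m\lfloor j/m\rfloor+1\big)$; (vi) $\mathsf c_m(n,k)$ counts the permutations of $[n]=\{1,\dots,n\}$ with exactly $k$ cycles built by the restricted insertion process in which the elements $1,2,\dots,n$ are inserted in order and element $i+1$ either opens a new cycle (as a fixed point) or is inserted, in cycle notation, immediately after one of the $m\lfloor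 i/m\rfloor$ smallest existing elements.
   Context: Second kind: $\mathsf S_m(n,k)$ is defined for $n,k\ge0$ by $\mathsf S_m(0,k)=\delta_{0,k}$, $\mathsf S_m(n,k)=0$ for $k<0$, and $\mathsf S_m(n+1,k)=m\lfloor k/m\rfloor\,\mathsf S_m(n,k)+\mathsf S_m(n,k-1)$. First kind (unsigned): $\mathsf c_m(n,k)$ is defined for $n,k\ge0$ by $\mathsf c_m(0,k)=\delta_{0,k}$, $\mathsf c_m(n,k)=0$ for $k<0$, and $\mathsf c_m(n+1,k)=m\lfloor n/m\rfloor\,\mathsf c_m(n,k)+\mathsf c_m(n,k-1)$. The $m$-falling and $m$-rising factorials are the polynomials $$x^{\underline{\underline n}_m}=\prod_{k=0}^{n-1}\big(x-m\lfloor k/m\rfloor\big),\qquad x^{\overline{\overline n}_m}=\prod_{k=0}^{n-1}\big(x+m\lfloor k/m\rfloor\big).$$ The $m$-Lah numbers $\mathsf L_m(n,k)$ are the connection coefficients defined by $x^{\overline{\overline n}_m}=\sum_{k}\mathsf L_m(n,k)\,x^{\underline{\underline k}_m}$ (with $\mathsf L_m(n,k)=0$ for $k<0$ or $k>n$). $e_d$ and $h_d$ are the elementary and complete homogeneous symmetric polynomials of degree $d$. *)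

(* Defs.v *)
From mathcomp Require Import all_boot all_order all_fingroup all_algebra.
From mathcomp Require Export mpoly.

Set Implicit Arguments.
Unset Strict Implicit.
Unset Printing Implicit Defensive.

Import GRing.Theory.
Local Open Scope ring_scope.

Definition weight (m j : nat) : nat := (m * (j %/ m))%N.

Fixpoint mstirling2 (m n k : nat) : nat :=
  if n is n'.+1 then
    (weight m k * mstirling2 m n' k
     + (if k is k'.+1 then mstirling2 m n' k' else 0))%N
  else (k == 0%N).

Fixpoint mstirling1 (m n k : nat) : nat :=
  if n is n'.+1 then
    (weight m n' * mstirling1 m n' k
     + (if k is k'.+1 then mstirling1 m n' k' else 0))%N
  else (k == 0%N).

Definition mfalling (m n : nat) : {poly int} :=
  \prod_(k < n) ('X - ((weight m k)%:R)%:P).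

Definition mrising (m n : nat) : {poly int} :=
  \prod_(k < n) ('X + ((weight m k)%:R)%:P).

Definition is_mlah (m : nat) (L : nat -> nat -> int) : Prop :=
  (forall n, mrising m n = \sum_(k < n.+1) L n k *: mfalling m k)
  /\ (forall n k, (n < k)%N -> L n k = 0).

Lemma size_mfalling m n : size (mfalling m n) = n.+1.
Proof. by rewrite size_prod_XsubC /index_enum -enumT size_enum_ord. Qed.

Lemma monic_mfalling m n : mfalling m n \is monic.
Proof. exact: monic_prod_XsubC. Qed.

Lemma size_mrising m n : size (mrising m n) = n.+1.
Proof.
have ->: mrising m n = \prod_(k < n) ('X - (- (weight m k)%:R)%:P).
  by apply: eq_bigr => k _; rewrite polyCN opprK.
by rewrite size_prod_XsubC /index_enum -enumT size_enum_ord.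
Qed.

Lemma coef_mfalling_diag m n : (mfalling m n)`_n = 1.
Proof. by have /monicP := monic_mfalling m n; rewrite lead_coefE size_mfalling. Qed.

Lemma mfalling_coord m N (p : {poly int}) : (size p <= N)%N ->
  {a : nat -> int | p = \sum_(k < N) a k *: mfalling m k
                    & forall k, (N <= k)%N -> a k = 0}.
Proof.
elim: N p => [|N IHN] p szp.
  exists (fun=> 0) => //; rewrite big_ord0; apply/eqP.
  by rewrite -size_poly_leq0.
have szq : (size (p - p`_N *: mfalling m N)%R <= N)%N.
  apply/leq_sizeP => j; rewrite leq_eqVlt => /predU1P[<-|ltNj].
    by rewrite coefB coefZ coef_mfalling_diag mulr1 subrr.
  rewrite coefB coefZ [p`_j](leq_sizeP _ _ szp) // [X in _ * X]nth_default.
    by rewrite mulr0 subrr.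
  by rewrite size_mfalling.
have [a pE a0] := IHN _ szq.
exists (fun k => if k == N then p`_N else a k).
  rewrite big_ord_recr /= eqxx -[LHS](subrK (p`_N *: mfalling m N)) {1}pE.
  by congr (_ + _); apply: eq_bigr => i _; rewrite ltn_eqF.
by move=> k ltNk; rewrite gtn_eqF // a0 // ltnW.
Qed.

Lemma mlah_exists m : {L : nat -> nat -> int | is_mlah m L}.
Proof.
pose c n := mfalling_coord m (eq_leq (size_mrising m n)).
by exists (fun n => s2val (c n)); split=> n; case: (c n).
Qed.

Lemma mfalling_free m N (a : nat -> int) :
  \sum_(k < N) a k *: mfalling m k = 0 -> forall k, (k < N)%N -> a k = 0.
Proof.
elim: N => // N IHN aE.
have aN : a N = 0.
  have := congr1 (fun p : {poly int} => p`_N) aE.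
  rewrite /= big_ord_recr coefD coefZ /= coef_mfalling_diag mulr1 coef0.
  rewrite coef_sum big1 ?add0r // => i _.
  by rewrite coefZ nth_default ?mulr0 // size_mfalling.
move: aE; rewrite big_ord_recr /= aN scale0r addr0 => /IHN a0 k.
by rewrite ltnS leq_eqVlt => /predU1P[->|/a0].
Qed.

Lemma is_mlah_unique m L L' : is_mlah m L -> is_mlah m L' -> L =2 L'.
Proof.
case=> LE L0 [L'E L'0] n k; case: (leqP k n) => [lekn|ltnk]; last first.
  by rewrite L0 ?L'0.
apply/eqP; rewrite -subr_eq0; apply/eqP.
apply: (mfalling_free (N := n.+1) (m := m) (a := fun k => L n k - L' n k)) => //.
under eq_bigr do rewrite scalerBl.
by rewrite sumrB -LE -L'E subrr.
Qed.

(* Pinned down by [mlahP] and [is_mlah_unique]. *)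
Definition mlah (m : nat) : nat -> nat -> int := sval (mlah_exists m).

Lemma mlahP m : is_mlah m (mlah m).
Proof. exact: svalP. Qed.

(* Infinite matrices are indexed by nat * nat.  In the product, row n of a
   lower-triangular A is supported on columns 0..n, so the sum is complete. *)
Definition lower_triangular (A : nat -> nat -> int) : Prop :=
  forall n k, (n < k)%N -> A n k = 0.

Definition ltmul (A B : nat -> nat -> int) (n k : nat) : int :=
  \sum_(j < n.+1) A n j * B j k.

Definition ltid (n k : nat) : int := (n == k)%:R.

Definition lt_inverses (A B : nat -> nat -> int) : Prop :=
  [/\ lower_triangular A, lower_triangular B,
      ltmul A B =2 ltid & ltmul B A =2 ltid].

(* For n < k the truncated exponent is harmless, as the entry is 0. *)
Definition signed_mstirling1 (m n k : nat) : int :=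
  (-1) ^+ (n - k) * (mstirling1 m n k)%:R.

(* The counterpart of [mesym]: the sum of all monomials of degree d. *)
Definition mhsym (n : nat) (R : nzRingType) (d : nat) : {mpoly R[n]} :=
  \sum_(t : 'X_{1..n < d.+1} | mdeg t == d) 'X_[t].

(* A formal power series is its sequence of coefficients. *)
Section FormalPowerSeries.
Variable R : comUnitRingType.
Implicit Types f g : nat -> R.

Definition fps_of_poly (p : {poly R}) : nat -> R := fun n => p`_n.

Definition fps_mul f g : nat -> R := fun n => \sum_(i < n.+1) f (n - i)%N * g i.

(* The coefficients g_0, ..., g_(n-1) of 1/f, obtained by solving f * g = 1
   degree by degree; meaningful when f 0 is a unit, see [fps_mulV]. *)
Fixpoint fps_inv_seq f (n : nat) : seq R :=
  if n is n'.+1 then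
    let g := fps_inv_seq f n' in
    rcons g ((f 0%N)^-1 * ((n' == 0%N)%:R - \sum_(i < n') f (n' - i)%N * g`_i))
  else [::].

Definition fps_inv f : nat -> R := fun n => (fps_inv_seq f n.+1)`_n.

Definition fps_div f g : nat -> R := fps_mul f (fps_inv g).

Lemma size_fps_inv_seq f n : size (fps_inv_seq f n) = n.
Proof. by elim: n => //= n IHn; rewrite size_rcons IHn. Qed.

Lemma nth_fps_inv_seq f n i : (i < n)%N -> (fps_inv_seq f n)`_i = fps_inv f i.
Proof.
elim: n => // n IHn; rewrite ltnS leq_eqVlt => /predU1P[->//|ltin].
by rewrite /= nth_rcons size_fps_inv_seq ltin IHn.
Qed.

Lemma fps_mulV f : f 0%N \is a GRing.unit ->
  forall n, fps_mul f (fps_inv f) n = (n == 0%N)%:R.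
Proof.
move=> f0 n; rewrite /fps_mul big_ord_recr /= subnn {2}/fps_inv /=.
rewrite nth_rcons size_fps_inv_seq ltnn eqxx mulVKr //.
under [X in _ - X]eq_bigr do rewrite nth_fps_inv_seq //.
by rewrite addrC subrK.
Qed.

End FormalPowerSeries.

(* The elements 1, ..., n are the ordinals 0, ..., n-1 of 'I_n, so the element
   inserted in a permutation of 'I_n is [ord_max : 'I_n.+1], and the embedding
   of 'I_n in 'I_n.+1 is [lift ord_max]. *)
Definition insert_fixed n (s : 'S_n) : 'S_n.+1 := lift_perm ord_max ord_max s.

(* (s * t)%g x = t (s x), so j is sent to the new element and the new element
   to s j: in cycle notation, (.. j (s j) ..) becomes (.. j new (s j) ..). *)
Definition insert_after n (j : 'I_n) (s : 'S_n) : 'S_n.+1 :=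
  (tperm (lift ord_max j) ord_max * insert_fixed s)%g.

Lemma insert_afterE n (j : 'I_n) (s : 'S_n) :
  [/\ insert_after j s (lift ord_max j) = ord_max,
      insert_after j s ord_max = lift ord_max (s j)
    & forall i, i != j ->
        insert_after j s (lift ord_max i) = lift ord_max (s i)].
Proof.
split; rewrite /insert_after /insert_fixed.
- by rewrite permM tpermL lift_perm_id.
- by rewrite permM tpermR lift_perm_lift.
- move=> i neij; rewrite permM tpermD ?lift_perm_lift ?neq_lift //.
  by rewrite (inj_eq lift_inj) eq_sym.
Qed.

Fixpoint restricted_insertion (m n : nat) : {set 'S_n} :=
  match n return {set 'S_n} with
  | 0 => [set 1%g]
  | i.+1 =>
      [set insert_fixed s | s in restricted_insertion m i]
      :|: [set insert_after j s | s in restricted_insertion m i,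
                                  j in [set j : 'I_i | (j < m * (i %/ m))%N]]
  end.

(* Main.v *)
Require Import Defs.
From mathcomp Require Import all_boot all_order all_fingroup all_algebra.
From mathcomp Require Import mpoly.

Import GRing.Theory.
Local Open Scope ring_scope.

(** Write w_j for the weight of j, and call rising and falling factorials the
    products of the x + w_j and of the x - w_j for j < n.

    All of the algebra is a change of basis in Z[x].  The recurrence of the first
    kind is that of the coefficients of the rising factorials, and up to signs
    of the falling ones ([coef_mrising], [coef_mfalling]).  The recurrence of the
    second kind is that of the coordinates of x^n on the falling factorials
    ([exprX_mfalling]), because x f_k = f_(k+1) + w_k f_k for the k-th falling
    factorial f_k.  As monomials and falling factorials are both bases, the two
    transition matrices are inverse to each other ([mstirling_inverses]), and the
    m-Lah numbers are the composite of the transitions from rising factorials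
    to monomials and from monomials to falling factorials ([is_mlah_sum]);
    their recurrence follows from x + w_n = (x - w_k) + (w_n + w_k).

    The elementary symmetric formula is Vieta's formula.  The complete
    homogeneous one compares recurrences: splitting monomials according to
    whether they contain the last variable gives
    h_(d+1)(w_1..w_(k+1)) = h_(d+1)(w_1..w_k) + w_(k+1) h_d(w_1..w_(k+1)),
    which is the recurrence of the second kind at row d + k ([mhsymS],
    [mstirling2_mhsym_add]).  The same recurrence, read on the column series
    S_k, is S_(k+1) (1 - w_(k+1) x) = x S_k, whence the generating function.

    Finally, opening a new cycle adds one cycle and inserting after an element
    adds none; both operations are injective with disjoint images, and there are
    w_n admissible elements at the step from n to n + 1.  Thus the insertion
    process obeys the recurrence of the first kind
    ([card_restricted_insertionS]). *)

(** * The first kind as coefficients *)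

Lemma mstirling1_small m n k : (n < k)%N -> mstirling1 m n k = 0%N.
Proof.
elim: n k => [|n IHn] [|k] //= ltnk.
by rewrite !IHn ?muln0 // ltnW.
Qed.

Lemma coef_mrising m n k : (mrising m n)`_k = (mstirling1 m n k)%:R.
Proof.
elim: n k => [|n IHn] k; first by rewrite /mrising big_ord0 coef1.
rewrite /mrising big_ord_recr /= -/(mrising m n) mulrDr coefD coefMX coefMC.
by case: k => [|k]; rewrite /= !IHn natrD natrM mulrC addrC.
Qed.

(** Beyond the diagonal the truncated exponent n - k loses the sign, but the
    entries vanish there, so the recurrence holds for every k. *)
Lemma signed_mstirling1_rec m n k :
  signed_mstirling1 m n.+1 k =
  (if k is k'.+1 then signed_mstirling1 m n k' else 0)
  - (weight m n)%:R * signed_mstirling1 m n k.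
Proof.
rewrite /signed_mstirling1; case: k => [|k] /=.
  by rewrite !subn0 exprS addn0 natrM add0r mulN1r mulNr mulrCA.
rewrite subSS natrD natrM mulrDr addrC; congr (_ + _).
case: (ltnP k n) => [ltkn|lenk]; last first.
  by rewrite mstirling1_small ?ltnS // !mulr0 oppr0.
by rewrite -[in LHS](subnSK ltkn) exprS mulN1r mulNr mulrCA.
Qed.

Lemma coef_mfalling m n k : (mfalling m n)`_k = signed_mstirling1 m n k.
Proof.
elim: n k => [|n IHn] k.
  by rewrite /mfalling big_ord0 coef1 /signed_mstirling1 mul1r.
rewrite /mfalling big_ord_recr /= -/(mfalling m n) mulrBr coefB coefMX coefMC.
rewrite signed_mstirling1_rec !IHn [_%:R * _]mulrC.
by case: k => [|k] /=; rewrite ?IHn.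
Qed.

Lemma poly_sum_coef (R : nzRingType) n (p : {poly R}) :
  (size p <= n)%N -> p = \sum_(k < n) p`_k *: 'X^k.
Proof.
move=> szp; apply/polyP=> i; rewrite -poly_def coef_poly.
by case: ltnP => // leni; rewrite nth_default // (leq_trans szp).
Qed.

(** The row sum is the value of the m-rising factorial at 1. *)
Lemma sum_mstirling1 m n :
  (\sum_(k < n.+1) mstirling1 m n k = \prod_(j < n) (weight m j + 1))%N.
Proof.
apply/eqP; rewrite -(Num.Theory.eqr_nat int) natr_sum natr_prod; apply/eqP.
transitivity (mrising m n).[1].
  rewrite horner_coef size_mrising; apply: eq_bigr => k _.
  by rewrite coef_mrising expr1n mulr1.
rewrite horner_prod; apply: eq_bigr => j _.
by rewrite !hornerE natrD addrC.
Qed.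

(** Vieta's formula for the m-falling factorial; its sign is the one carried by
    the signed numbers of the first kind. *)
Lemma mstirling1_mesym m n k : (k <= n)%N ->
  (mstirling1 m n k)%:R =
    (mesym n int (n - k)).@[fun i : 'I_n => (weight m i)%:R].
Proof.
move=> lekn; pose cs := [tuple (weight m i)%:R : int | i < n].
have csE : \prod_(c <- cs) ('X - c%:P) = mfalling m n.
  by rewrite big_tuple; apply: eq_bigr => i _; rewrite tnth_mktuple.
have ltn : (n - k < n.+1)%N by rewrite ltnS leq_subr.
have := mroots_coeff cs (Ordinal ltn); rewrite csE /= subKn //.
rewrite coef_mfalling => /(can_inj (mulKr _))-> //.
  by apply: meval_eq => i; rewrite tnth_mktuple.
by rewrite unitrX // unitrN1.
Qed.

(** * The second kind as connection coefficients *)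

Lemma mstirling2_small m n k : (n < k)%N -> mstirling2 m n k = 0%N.
Proof.
elim: n k => [|n IHn] [|k] //= ltnk.
by rewrite !IHn ?muln0 // ltnW.
Qed.

Lemma mstirling2_diag m n : mstirling2 m n n = 1%N.
Proof. by elim: n => //= n ->; rewrite mstirling2_small // muln0. Qed.

Lemma mstirling2_0 m n : mstirling2 m n 0 = (n == 0%N).
Proof. by case: n => //= n; rewrite /weight div0n muln0. Qed.

(** Multiplication by the variable is bidiagonal in the basis of m-falling
    factorials; both recurrences that have the weight of k as a multiplier come
    from this relation. *)
Lemma mulX_mfalling m k :
  'X * mfalling m k = mfalling m k.+1 + (weight m k)%:R *: mfalling m k.
Proof.
rewrite [mfalling m k.+1]big_ord_recr /= -/(mfalling m k).
by rewrite mulrBr -mul_polyC [_%:P * _]mulrC subrK mulrC.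
Qed.

(** The upper bound N is free so that expansions of several powers can be added
    over one common index range. *)
Lemma exprX_mfalling m n N : (n <= N)%N ->
  'X^n = \sum_(k < N.+1) (mstirling2 m n k)%:R *: mfalling m k.
Proof.
elim: n => [|n IHn] lenN.
  rewrite big_ord_recl big1 ?addr0 => [|i _]; last by rewrite scale0r.
  by rewrite scale1r /mfalling big_ord0.
rewrite exprS IHn 1?ltnW // mulr_sumr.
under eq_bigr do rewrite -scalerAr mulX_mfalling scalerDr scalerA.
rewrite big_split /= big_ord_recr /= mstirling2_small // scale0r addr0.
under [RHS]eq_bigr do rewrite natrD scalerDl.
rewrite [RHS]big_split /= addrC; congr (_ + _).
  by apply: eq_bigr => k _; rewrite natrM mulrC.
by rewrite [RHS]big_ord_recl /= scale0r add0r.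
Qed.

(** Change of basis: the coordinates of p on the m-falling factorials are
    obtained from its coefficients by the matrix of second kind.  Applied to the
    m-falling factorials it gives one half of the inversion, applied to the
    m-rising ones it gives the m-Lah numbers. *)
Lemma poly_mfalling m n N (p : {poly int}) : (size p <= n.+1)%N -> (n <= N)%N ->
  p = \sum_(k < N.+1)
        (\sum_(j < n.+1) p`_j * (mstirling2 m j k)%:R) *: mfalling m k.
Proof.
move=> szp lenN; rewrite {1}(poly_sum_coef _ _ _ szp).
under [RHS]eq_bigr do rewrite scaler_suml.
rewrite exchange_big /=; apply: eq_bigr => j _.
rewrite (exprX_mfalling m _ N) ?(leq_trans (leq_ord j) lenN) // scaler_sumr.
by apply: eq_bigr => k _; rewrite scalerA.
Qed.

Lemma mfalling_coord_inj m N (a b : nat -> int) :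
  \sum_(k < N) a k *: mfalling m k = \sum_(k < N) b k *: mfalling m k ->
  forall k, (k < N)%N -> a k = b k.
Proof.
move=> eqab k ltkN; apply/eqP; rewrite -subr_eq0; apply/eqP.
apply: (mfalling_free (a := fun k => a k - b k) (m := m) (N := N)) => //.
by under eq_bigr do rewrite scalerBl; rewrite sumrB eqab subrr.
Qed.

(** Each product re-expands a basis in itself through the other one, so that
    uniqueness of coordinates forces the identity matrix. *)
Lemma mstirling_inverses m :
  lt_inverses (signed_mstirling1 m) (fun n k => (mstirling2 m n k)%:R).
Proof.
split=> [n k ltnk|n k ltnk|n k|n k].
- by rewrite /signed_mstirling1 mstirling1_small ?mulr0.
- by rewrite mstirling2_small.
- suff fallE : \sum_(i < (n + k).+1) ltmul (signed_mstirling1 m)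
        (fun n k => (mstirling2 m n k)%:R) n i *: mfalling m i
      = \sum_(i < (n + k).+1) ltid n i *: mfalling m i.
    by rewrite (mfalling_coord_inj _ _ _ _ fallE) // ltnS leq_addl.
  (* n + k is an index range that contains both the row n and the column k. *)
  transitivity (mfalling m n).
    rewrite [RHS](poly_mfalling m _ _ _ (eq_leq (size_mfalling m n))
                                        (leq_addr k n)).
    apply: eq_bigr => i _; congr (_ *: _).
    by apply: eq_bigr => j _; rewrite coef_mfalling.
  have ltnN : (n < (n + k).+1)%N by rewrite ltnS leq_addr.
  rewrite (bigD1 (Ordinal ltnN)) //= /ltid eqxx scale1r big1 ?addr0 // => i.
  by rewrite -val_eqE /= eq_sym => /negPf->; rewrite scale0r.
- rewrite /ltid /ltmul eq_sym -coefXn (exprX_mfalling m _ _ (leqnn n)) coef_sum.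
  by apply: eq_bigr => j _; rewrite coefZ coef_mfalling.
Qed.

(** * The m-Lah numbers *)

Lemma is_mlah_sum m :
  is_mlah m (fun n k =>
    \sum_(j < n.+1) (mstirling1 m n j)%:R * (mstirling2 m j k)%:R).
Proof.
split=> [n|n k ltnk].
  rewrite {1}(poly_mfalling m _ _ _ (eq_leq (size_mrising m n)) (leqnn n)).
  by under eq_bigr do under eq_bigr do rewrite coef_mrising.
rewrite big1 // => j _.
by rewrite mstirling2_small ?mulr0 // (leq_ltn_trans (leq_ord j) ltnk).
Qed.

(** Expanding (x + w_n) times the rising factorial by
    x + w_n = (x - w_k) + (w_n + w_k) on the k-th term shows that the right-hand
    side is also a family of connection coefficients; these are unique. *)
Lemma mlah_rec m n k :
  mlah m n.+1 k = (weight m n + weight m k)%:R * mlah m n k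
                  + (if k is k'.+1 then mlah m n k' else 0).
Proof.
have [LE L0] := mlahP m.
(* Not a recursive definition: row n.+1 of L' is read off row n of mlah. *)
pose L' i j := if i is n.+1 then (weight m n + weight m j)%:R * mlah m n j
                 + (if j is j'.+1 then mlah m n j' else 0) else mlah m 0%N j.
suff: is_mlah m L' by move/(is_mlah_unique (mlahP m)) => ->.
split=> [[|i]|[|i] [|j] //= ltij]; [exact: LE | | exact: L0 |]; last first.
  by rewrite !L0 ?mulr0 // ltnW.
rewrite [LHS]big_ord_recr /= -/(mrising m i) LE mulr_suml.
under [LHS]eq_bigr => j _.
  rewrite -scalerAl mulrDr [_ * 'X]mulrC mulX_mfalling [_ * _%:P]mulrC.
  rewrite mul_polyC -addrA -scalerDl -natrD scalerDr scalerA.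
  over.
rewrite big_split /=; under [RHS]eq_bigr do rewrite scalerDl.
rewrite [RHS]big_split /= addrC; congr (_ + _).
  rewrite [RHS]big_ord_recr /= L0 // mulr0 scale0r addr0.
  by apply: eq_bigr => j _; rewrite mulrC addnC.
by rewrite [RHS]big_ord_recl /= scale0r add0r.
Qed.

(** * Complete homogeneous symmetric polynomials *)

Lemma mcoeff_mhsym n (R : nzRingType) d (t : 'X_{1..n}) :
  (mhsym n R d)@_t = (mdeg t == d)%:R.
Proof.
rewrite /mhsym raddf_sum /=; under eq_bigr do rewrite mcoeffX.
case: eqP => [dt|ndt].
  have ltd : (mdeg t < d.+1)%N by rewrite dt.
  rewrite (bigD1 (BMultinom ltd)) /= ?dt ?eqxx // big1 ?addr0 // => u.
  by case/andP=> _; rewrite -val_eqE /= => /negPf->.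
rewrite big1 // => u /eqP du; case: eqP => // ut.
by case: ndt; rewrite -ut.
Qed.

Lemma mdeg_mnmwiden n (t : 'X_{1..n}) : mdeg (mnmwiden t) = mdeg t.
Proof.
rewrite !mdegE big_ord_recr /= mnmwiden_ordmax addn0.
by apply: eq_bigr => i _; rewrite mnmwiden_widen.
Qed.

(** A monomial of degree d.+1 either avoids the last variable, and then lives in
    n variables, or is the last variable times a monomial of degree d. *)
Lemma mhsymS n (R : nzRingType) d :
  mhsym n.+1 R d.+1 = mwiden (mhsym n R d.+1) + mhsym n.+1 R d * 'X_ord_max.
Proof.
apply/mpolyP=> t; rewrite mcoeffD mcoeff_mhsym.
(* If the last exponent of t is 0, then t comes from n variables and the product
   by the last variable contributes nothing to it; if it is positive, then t is
   not widened and the roles are exchanged. *)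
case: (posnP (t ord_max)) => [t0|t_gt0].
  pose u : 'X_{1..n} := [multinom t (widen_ord (leqnSn n) i) | i < n].
  have -> : t = mnmwiden u.
    apply/mnmP=> i; case: (unliftP ord_max i) => [j|] ->.
      rewrite (_ : lift _ _ = widen_ord (leqnSn n) j); last first.
        by apply: val_inj; rewrite /= /bump leqNgt ltn_ord.
      by rewrite mnmwiden_widen mnmE.
    by rewrite mnmwiden_ordmax.
  rewrite mwiden_mnmwiden mcoeff_mhsym mdeg_mnmwiden mulr_suml raddf_sum /=.
  rewrite big1 ?addr0 // => v _; rewrite -mpolyXD mcoeffX; case: eqP => // vu.
  have := congr1 (fun w : 'X_{1..n.+1} => w ord_max) vu.
  by rewrite /= mnmwiden_ordmax mnmDE mnm1E eqxx addn1.
have tE : t = (U_(ord_max) + (t - U_(ord_max)))%MM.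
  by rewrite addmC submK // lep1mP -lt0n.
rewrite {2 3}tE mcoeffMX mcoeff_mhsym.
rewrite {1}tE mdegD mdeg1 add1n eqSS.
rewrite (mwidenE (leqnn _)) raddf_sum big1 /= ?add0r // => v _.
rewrite mcoeffZ mcoeffX; case: eqP => [vt|]; rewrite ?mulr0 //.
by move: t_gt0; rewrite tE -vt mnmwiden_ordmax.
Qed.

Lemma mhsym0 n (R : nzRingType) : mhsym n R 0 = 1.
Proof.
by apply/mpolyP=> t; rewrite mcoeff_mhsym mcoeff1 mdeg_eq0.
Qed.

Lemma mhsym0S (R : nzRingType) d : mhsym 0 R d.+1 = 0.
Proof.
apply/mpolyP=> t; rewrite mcoeff_mhsym mcoeff0 mdegE big_ord0.
by [].
Qed.

Lemma meval_mwiden n (R : comNzRingType) (p : {mpoly R[n]}) (v : 'I_n.+1 -> R) :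
  (mwiden p).@[v] = p.@[fun i => v (widen_ord (leqnSn n) i)].
Proof.
rewrite /mwiden /mmap raddf_sum /= mevalE; apply: eq_bigr => t _.
rewrite mevalM mevalC /mmap1 rmorph_prod; congr (_ * _).
by apply: eq_bigr => i _; rewrite rmorphXn /= mevalXU.
Qed.

Lemma meval_mhsymS n (R : comNzRingType) d (v : nat -> R) :
  (mhsym n.+1 R d.+1).@[fun i => v i] =
  (mhsym n R d.+1).@[fun i => v i] + v n * (mhsym n.+1 R d).@[fun i => v i].
Proof.
by rewrite mhsymS mevalD meval_mwiden mevalM mevalXU mulrC /= mulrC.
Qed.

(** Indexing the row as d + k turns the recurrence of the second kind into the
    one of the complete homogeneous polynomials: adjoining the variable number
    k.+1 is a double induction on k and d. *)
Lemma mstirling2_mhsym_add m k d :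
  (mstirling2 m (d + k) k)%:R =
    (mhsym k int d).@[fun i : 'I_k => (weight m i.+1)%:R].
Proof.
elim: k d => [|k IHk] d.
  rewrite mstirling2_0 addn0; case: d => [|d].
    by rewrite mhsym0 meval1.
  by rewrite mhsym0S meval0.
elim: d => [|d IHd]; first by rewrite mhsym0 meval1 mstirling2_diag.
rewrite (meval_mhsymS _ _ _ (fun i => (weight m i.+1)%:R)) -IHd -IHk addSn /=.
by rewrite natrD natrM addrC addnS.
Qed.

(** * Column generating functions *)

(** Associativity of the product of series is inherited from polynomials, as
    a coefficient depends on finitely many coefficients of the factors. *)
Lemma coef_fps_mul_trunc (R : comUnitRingType) (f g : nat -> R) n N :
  (n < N)%N ->
  fps_mul f g n = ((\poly_(i < N) f i) * (\poly_(i < N) g i))`_n.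
Proof.
move=> ltnN; rewrite coefMr; apply: eq_bigr => i _.
rewrite !coef_poly (leq_ltn_trans (leq_subr _ _) ltnN).
by rewrite (leq_trans (ltn_ord i) ltnN).
Qed.

Lemma eq_fps_mul (R : comUnitRingType) (f f' g g' : nat -> R) :
  f =1 f' -> g =1 g' -> fps_mul f g =1 fps_mul f' g'.
Proof. by move=> ff' gg' n; apply: eq_bigr => i _; rewrite ff' gg'. Qed.

Lemma fps_mulA (R : comUnitRingType) (f g h : nat -> R) :
  fps_mul f (fps_mul g h) =1 fps_mul (fps_mul f g) h.
Proof.
move=> n; rewrite !(@coef_fps_mul_trunc _ _ _ n n.+1) //.
set F := \poly_(i < _) f i; set H := \poly_(i < _) h i.
pose G := \poly_(i < n.+1) g i.
transitivity ((F * (G * H))`_n).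
  rewrite !coefM; apply: eq_bigr => i _; congr (_ * _).
  rewrite coef_poly ltnS leq_subr.
  by rewrite (@coef_fps_mul_trunc _ _ _ _ n.+1) ?ltnS ?leq_subr.
rewrite mulrA [LHS]coefM [RHS]coefM; apply: eq_bigr => i _; congr (_ * _).
by rewrite coef_poly ltn_ord (@coef_fps_mul_trunc _ _ _ _ n.+1).
Qed.

Lemma fps_mul_poly (R : comUnitRingType) (p q : {poly R}) :
  fps_mul (fps_of_poly p) (fps_of_poly q) =1 fps_of_poly (p * q).
Proof. by move=> n; rewrite /fps_of_poly coefMr. Qed.

Lemma fps_mul1r (R : comUnitRingType) (f : nat -> R) :
  fps_mul f (fun n => (n == 0%N)%:R) =1 f.
Proof.
move=> n; rewrite /fps_mul big_ord_recl /= subn0 mulr1 big1 ?addr0 // => i _.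
by rewrite mulr0.
Qed.

Lemma fps_div_unique (R : comUnitRingType) (f g h : nat -> R) :
  g 0%N \is a GRing.unit -> fps_mul h g =1 f -> h =1 fps_div f g.
Proof.
move=> g0 hg n; rewrite /fps_div -(eq_fps_mul _ _ _ _ _ hg (frefl _)).
by rewrite -fps_mulA (eq_fps_mul _ _ _ _ _ (frefl h) (fps_mulV g0)) fps_mul1r.
Qed.

Lemma fps_mul_linear (R : comUnitRingType) (f : nat -> R) a n :
  fps_mul f (fps_of_poly (1 - a *: 'X)) n =
  f n - (if n is n'.+1 then a * f n' else 0).
Proof.
rewrite /fps_mul /fps_of_poly; case: n => [|n].
  by rewrite big_ord1 coefB coef1 coefZ coefX /= mulr0 !subr0 mulr1.
rewrite 2!big_ord_recl big1 => [|i _]; last first.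
  by rewrite coefB coef1 coefZ coefX /= mulr0 subr0 mulr0.
rewrite !coefB !coef1 !coefZ !coefX /= subn0 subn1 mulr0 mulr1 subr0 mulr1.
by rewrite sub0r addr0 mulrN mulrC.
Qed.

Lemma fps_mulX (R : comUnitRingType) (f : nat -> R) n :
  fps_mul f (fps_of_poly 'X) n = if n is n'.+1 then f n' else 0.
Proof.
rewrite /fps_mul /fps_of_poly; case: n => [|n].
  by rewrite big_ord1 coefX mulr0.
rewrite 2!big_ord_recl big1 => [|i _]; last by rewrite coefX mulr0.
by rewrite !coefX /= mulr0 mulr1 add0r addr0 subn1.
Qed.

(** With S_k the k-th column series, the recurrence says
    S_(k+1) (1 - w_(k+1) x) = x S_k, and the product telescopes. *)
Lemma fps_mul_prod_mstirling2 m k :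
  fps_mul (fun n => (mstirling2 m n k)%:R)
    (fps_of_poly (\prod_(1 <= j < k.+1) (1 - (weight m j)%:R *: 'X)))
  =1 fps_of_poly ('X^k : {poly int}).
Proof.
elim: k => [|k IHk] n.
  rewrite big_nil (eq_fps_mul _ _ (fps_of_poly 1) _ _ _ (frefl _)) => [|i].
    by rewrite fps_mul_poly mulr1.
  by rewrite mstirling2_0 /fps_of_poly coef1.
rewrite big_nat_recr //=.
set P := \prod_(1 <= j < k.+1) _; set Q := 1 - _.
pose S j n : int := (mstirling2 m n j)%:R.
have SQ : fps_mul (S k.+1) (fps_of_poly Q) =1 fps_mul (S k) (fps_of_poly 'X).
  move=> i; rewrite fps_mul_linear fps_mulX.
  by case: i => [|i]; rewrite /S ?subr0 //= natrD natrM addrAC subrr add0r.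
have mulP (f : nat -> int) p q : fps_mul f (fps_of_poly (p * q))
    =1 fps_mul (fps_mul f (fps_of_poly p)) (fps_of_poly q).
  move=> i; rewrite -fps_mulA.
  by rewrite -(eq_fps_mul _ _ _ _ _ (frefl _) (fps_mul_poly _ _ _)).
rewrite mulrC mulP (eq_fps_mul _ _ _ _ _ SQ (frefl _)) -mulP mulrC mulP.
by rewrite (eq_fps_mul _ _ _ _ _ IHk (frefl _)) fps_mul_poly exprSr.
Qed.

Lemma mstirling2_gf m k :
  (fun n => (mstirling2 m n k)%:R) =1
    fps_div (fps_of_poly ('X^k : {poly int}))
      (fps_of_poly (\prod_(1 <= j < k.+1) (1 - (weight m j)%:R *: 'X))).
Proof.
apply: fps_div_unique; last exact: fps_mul_prod_mstirling2.
rewrite /fps_of_poly -horner_coef0 horner_prod big1 ?unitr1 // => j _.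
by rewrite !hornerE.
Qed.

(** * Cycles of permutations built by insertion *)

Lemma insert_fixed_inj n : injective (@insert_fixed n).
Proof.
move=> s t eqst; apply/permP=> i; apply: (@lift_inj _ ord_max).
by rewrite -!(lift_perm_lift ord_max ord_max) -/(insert_fixed s) eqst.
Qed.

(** The element j is recovered as the preimage of the new element, and then s by
    cancelling the transposition. *)
Lemma insert_after_inj n :
  injective (fun p : 'S_n * 'I_n => insert_after p.2 p.1).
Proof.
case=> s i [t j] /= eqst.
have eqij : i = j.
  have [imax _ _] := insert_afterE i s; have [jmax _ _] := insert_afterE j t.
  apply: (@lift_inj _ ord_max); apply: (@perm_inj _ (insert_after i s)).
  by rewrite imax eqst.
by move: eqst; rewrite eqij => /mulgI/insert_fixed_inj->.
Qed.

Lemma insert_fixedX n (s : 'S_n) i :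
  (insert_fixed s ^+ i = insert_fixed (s ^+ i))%g.
Proof.
elim: i => [|i IHi]; first by rewrite !expg0 /insert_fixed lift_perm1.
by rewrite !expgS IHi /insert_fixed lift_permM.
Qed.

Lemma porbit_insert_fixed_max n (s : 'S_n) :
  porbit (insert_fixed s) ord_max = [set ord_max].
Proof.
apply/setP=> y; rewrite inE; apply/porbitP/eqP=> [[i ->]|->].
  by rewrite insert_fixedX lift_perm_id.
by exists 0%N; rewrite expg0 perm1.
Qed.

Lemma porbit_insert_fixed_lift n (s : 'S_n) x :
  porbit (insert_fixed s) (lift ord_max x) = lift ord_max @: porbit s x.
Proof.
apply/setP=> y; apply/porbitP/imsetP=> [[i ->]|[_ /porbitP[i ->] ->]].
  by exists ((s ^+ i)%g x); rewrite ?mem_porbit // insert_fixedX lift_perm_lift.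
by exists i; rewrite insert_fixedX lift_perm_lift.
Qed.

(** The orbits are the lifts of the old ones and the orbit of the new point. *)
Lemma card_porbits_insert_fixed n (s : 'S_n) :
  #|porbits (insert_fixed s)| = #|porbits s|.+1.
Proof.
pose lifts := [set lift ord_max @: (A : {set 'I_n}) | A in porbits s].
have -> : porbits (insert_fixed s) = [set ord_max] |: lifts.
  apply/setP=> A; apply/imsetP/setU1P=> [[x _ ->]|[->|]].
  - case: (unliftP ord_max x) => [y|] ->; last first.
      by left; rewrite porbit_insert_fixed_max.
    by right; rewrite porbit_insert_fixed_lift; do 2!apply: imset_f.
  - by exists ord_max; rewrite ?porbit_insert_fixed_max.
  - case/imsetP=> _ /imsetP[x _ ->] ->; exists (lift ord_max x) => //.
    by rewrite porbit_insert_fixed_lift.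
rewrite cardsU1 card_imset; last exact/imset_inj/lift_inj.
rewrite (_ : [set ord_max] \notin lifts) //.
apply/imsetP=> -[A _ /setP/(_ ord_max)]; rewrite set11 => /esym/imsetP[x _].
by move/eqP; rewrite (negPf (neq_lift _ _)).
Qed.

(** Composing with the transposition of j and the new fixed point merges the
    singleton orbit of the latter into the orbit of j. *)
Lemma card_porbits_insert_after n (j : 'I_n) (s : 'S_n) :
  #|porbits (insert_after j s)| = #|porbits s|.
Proof.
have := porbits_mul_tperm (insert_fixed s) (lift ord_max j) ord_max.
rewrite porbit_insert_fixed_max inE eq_sym neq_lift /=.
rewrite card_porbits_insert_fixed -/(insert_after j s).
by rewrite addn1 addn2 => -[].
Qed.

Lemma card_ord_lt n b : (b <= n)%N -> #|[set j : 'I_n | (j < b)%N]| = b.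
Proof.
move=> lebn; rewrite -sum1dep_card -(big_ord_widen _ (fun=> 1%N)) //.
by rewrite sum1_card card_ord.
Qed.

(** The two ways of inserting a new element have disjoint images, as only the
    first one fixes it, and each is injective; so the cycle-counting numbers
    satisfy the recurrence of the first kind. *)
Lemma card_restricted_insertionS m n k :
  #|[set s in restricted_insertion m n.+1 | #|porbits s| == k]| =
  (weight m n * #|[set s in restricted_insertion m n | #|porbits s| == k]|
   + #|[set s in restricted_insertion m n | #|porbits s|.+1 == k]|)%N.
Proof.
set Rk := [set s in restricted_insertion m n | #|porbits s| == k].
set Rk1 := [set s in restricted_insertion m n | #|porbits s|.+1 == k].
pose J := [set j : 'I_n | (j < m * (n %/ m))%N].
pose ins (p : 'S_n * 'I_n) := insert_after p.2 p.1.
have -> : [set s in restricted_insertion m n.+1 | #|porbits s| == k] =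
    ins @: setX Rk J :|: @insert_fixed n @: Rk1.
  apply/setP=> t; rewrite !inE; apply/andP/orP.
    case=> /orP[/imsetP[s Rs ->]|/imset2P[s j Rs Jj ->]].
      by rewrite card_porbits_insert_fixed; right; rewrite imset_f // inE Rs.
    rewrite card_porbits_insert_after => ck; left; apply/imsetP.
    by exists (s, j); rewrite // in_setX inE Rs ck.
  case=> /imsetP[].
    case=> s j; rewrite in_setX inE /= => /andP[/andP[Rs ck] Jj] ->.
    rewrite /ins card_porbits_insert_after /=; split=> //.
    by apply/orP; right; apply/imset2P; exists s j.
  move=> s; rewrite inE => /andP[Rs ck] ->.
  by rewrite card_porbits_insert_fixed; split=> //; rewrite imset_f.
rewrite cardsU disjoint_setI0 ?cards0 ?subn0; last first.
  rewrite disjoints_subset; apply/subsetP=> _ /imsetP[[s j] _ ->].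
  rewrite inE; apply/imsetP=> -[t _ /(congr1 (fun u : 'S_n.+1 => u ord_max))].
  have [_ -> _] := insert_afterE j s; rewrite lift_perm_id => /eqP.
  by rewrite eq_sym (negPf (neq_lift _ _)).
rewrite !card_imset ?cardsX; [|exact: insert_fixed_inj|exact: insert_after_inj].
by rewrite card_ord_lt ?[(m * _)%N]mulnC ?leq_divM // mulnC [weight m n]mulnC.
Qed.

Lemma mstirling1_card m n k :
  mstirling1 m n k =
    #|[set s in restricted_insertion m n | #|porbits s| == k]|.
Proof.
elim: n k => [|n IHn] k.
  have porb0 : #|porbits (1%g : 'S_0)| = 0%N.
    apply/eqP; rewrite cards_eq0; apply/eqP/setP=> A; rewrite inE.
    by apply/imsetP=> -[[]].
  rewrite [RHS](_ : _ = #|[set s in [set 1%g : 'S_0] | k == 0%N]|).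
    case: k => [|k] /=; last by rewrite eq_card0 // => s; rewrite !inE andbF.
    by rewrite -(cards1 (1%g : 'S_0)); apply: eq_card => s; rewrite !inE andbT.
  apply: eq_card => s; rewrite !inE; case: eqVneq => // ->.
  by rewrite porb0 eq_sym.
rewrite card_restricted_insertionS /= -IHn; congr (_ + _)%N.
case: k => [|k]; last by rewrite IHn.
by rewrite eq_card0 // => s; rewrite !inE andbF.
Qed.

(** * Identities and enumeration of the m-Stirling numbers *)

Theorem theorem7p12 (m : nat) (hm : (1 <= m)%N) :
  (* (i) *)
  (forall n : nat,
     [/\ mrising m n = \sum_(k < n.+1) (mstirling1 m n k)%:R *: 'X^k,
         mfalling m n =
           \sum_(k < n.+1) ((-1) ^+ (n - k) * (mstirling1 m n k)%:R) *: 'X^k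
       & 'X^n = \sum_(k < n.+1) (mstirling2 m n k)%:R *: mfalling m k])
  (* (ii) *)
  /\ lt_inverses (signed_mstirling1 m)
       (fun n k : nat => (mstirling2 m n k)%:R)
  (* (iii) *)
  /\ [/\ forall n k : nat, (k <= n)%N ->
           (mstirling1 m n k)%:R =
             (mesym n int (n - k)).@[fun i : 'I_n => (weight m i)%:R],
         forall n k : nat, (k <= n)%N ->
           (mstirling2 m n k)%:R =
             (mhsym k int (n - k)).@[fun i : 'I_k => (weight m i.+1)%:R]
       & forall k : nat,
           (fun n : nat => (mstirling2 m n k)%:R) =1
             fps_div (fps_of_poly ('X^k : {poly int}))
               (fps_of_poly
                  (\prod_(1 <= j < k.+1) (1 - (weight m j)%:R *: 'X)))]
  (* (iv) *)
  /\ ((forall n k : nat,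
         mlah m n k =
           \sum_(j < n.+1) (mstirling1 m n j)%:R * (mstirling2 m j k)%:R)
      /\ (forall n k : nat,
            mlah m n.+1 k =
              (weight m n + weight m k)%:R * mlah m n k
              + (if k is k'.+1 then mlah m n k' else 0)))
  (* (v) *)
  /\ (forall n : nat,
        (\sum_(k < n.+1) mstirling1 m n k)%N = (\prod_(j < n) (weight m j + 1))%N)
  (* (vi) *)
  /\ (forall n k : nat,
        mstirling1 m n k =
          #|[set s in restricted_insertion m n | #|porbits s| == k]|).
Proof.
split.
  move=> n; split; last exact: exprX_mfalling.
    rewrite {1}(poly_sum_coef _ _ _ (eq_leq (size_mrising m n))).
    by apply: eq_bigr => k _; rewrite coef_mrising.
  rewrite {1}(poly_sum_coef _ _ _ (eq_leq (size_mfalling m n))).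
  by apply: eq_bigr => k _; rewrite coef_mfalling.
split; first exact: mstirling_inverses.
split.
  split; [exact: mstirling1_mesym | | exact: mstirling2_gf].
  by move=> n k lekn; rewrite -mstirling2_mhsym_add subnK.
split.
  split; last exact: mlah_rec.
  exact: is_mlah_unique (mlahP m) (is_mlah_sum m).
split; [exact: sum_mstirling1 | exact: mstirling1_card].
Qed.
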